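(* Let $n>2$ be an integer (odd or even) and $q\in\mathcal{B}_n$ with $wt(q)\in\{2,3\}$. Then there are no non-linear (balanced) $q$-nearly bent functions in $\mathcal{B}_n$.
   Context: $V_n=\{0,1\}^n$ (row vectors) and $\mathcal{B}_n$ is the set of Boolean functions $V_n\to\{0,1\}$. $wt(f)=|\{a: f(a)=1\}|$; $f$ is balanced if $wt(f)=2^{n-1}$. ''Non-linear'' means not affine (algebraic degree at least 2). $W(f,g)=\sum_{a\in V_n}(-1)^{f(a)+g(a)}$. $GL_n$ is the group of invertible $n\times n$ matrices over $\mathbb{F}_2$; $q_A(a)=q(aA)$; $W_q(f)(A)=W(f,q_A)$. $I_q=\sum_{a\in V_n}(-1)^{q(a)}$ and $\rho_q=\left\lceil\left(\frac{2^{2n}-I_q^2}{2^n-1}\right)^{1/2}\right\rceil$. A balanced $f\in\mathcal{B}_n$ is called $q$-nearly bent if $|W_q(f)(A)|\le\rho_q$ for all $A\in GL_n$. *)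

(* Defs.v *)
From mathcomp Require Import all_boot all_order all_algebra.
From mathcomp Require Import reals.

Set Implicit Arguments.
Unset Strict Implicit.
Unset Printing Implicit Defensive.

Import Order.TTheory GRing.Theory Num.Theory.
Local Open Scope ring_scope.

Definition boolfun (n : nat) := {ffun 'rV['F_2]_n -> 'F_2}.

Definition wt (n : nat) (f : boolfun n) : nat := #|[set a | f a == 1]|.

Definition balanced (n : nat) (f : boolfun n) : Prop := wt f = (2 ^ n.-1)%N.

Definition affine (n : nat) (f : boolfun n) : Prop :=
  exists (u : 'cV['F_2]_n) (b : 'F_2), forall a, f a = (a *m u) 0 0 + b.

(* The exponents below are elements of 'F_2, coerced to their representative
   0 or 1 in nat. *)
Definition W (n : nat) (f g : boolfun n) : int :=
  \sum_(a : 'rV['F_2]_n) (-1) ^+ (f a + g a)%R.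

Definition act (n : nat) (q : boolfun n) (A : 'M['F_2]_n) : boolfun n :=
  [ffun a => q (a *m A)].

Definition Wq (n : nat) (q f : boolfun n) (A : 'M['F_2]_n) : int :=
  W f (act q A).

Definition Iq (n : nat) (q : boolfun n) : int :=
  \sum_(a : 'rV['F_2]_n) (-1) ^+ q a.

Definition rho (R : realType) (n : nat) (q : boolfun n) : int :=
  Num.ceil (Num.sqrt
    ((2 ^+ (2 * n)%N - (Iq q)%:~R ^+ 2) / (2 ^+ n - 1) : R)).

Definition nearly_bent (R : realType) (n : nat) (q f : boolfun n) : Prop :=
  balanced f /\
  forall A : 'M['F_2]_n, A \in unitmx -> `|Wq q f A| <= rho R q.

(* Main.v *)
(** Write [S] for the support of [q]. As [f] is balanced, [Wq q f A] is minus
    twice the sum of [(-1)^f] over the preimage of [S] under [A]. If [f] were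
    constant on that preimage, the absolute value would be [2 * wt q], which
    exceeds [rho]; so [f] is constant on no linear image of [S]. Linear maps act
    transitively on linearly independent tuples, hence this constrains every
    configuration of the same linear type as [S]: [{0, y}], [{x, y}],
    [{0, x, y}], [{x, y, x + y}] or an independent triple. The half of the space
    where [f] differs from [f 0], or the other half, contains such a
    configuration, except for the type [{x, y, x + y}], where the condition says
    that the sum of any two points with [f <> f 0] satisfies [f = f 0]; counting
    then makes [{f = f 0}] a subgroup of index 2, so [f] is affine. *)

Require Import Defs.
From mathcomp Require Import all_boot all_order all_algebra.
From mathcomp Require Import reals.
From mathcomp Require Import lra zify.

Set Implicit Arguments.
Unset Strict Implicit.
Unset Printing Implicit Defensive.

Import Order.TTheory GRing.Theory Num.Theory.
Local Open Scope ring_scope.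

(** * Invertible matrices and independent tuples of vectors *)

Lemma row_free_col_mx (F : fieldType) (k n : nat) (u : 'rV[F]_n)
    (X : 'M[F]_(k, n)) :
  row_free X -> ~~ (u <= X)%MS -> row_free (col_mx u X).
Proof.
move=> freeX uX; apply: inj_row_free => v.
rewrite -[v]hsubmxK mul_row_col [lsubmx v]mx11_scalar mul_scalar_mx.
set a := lsubmx v 0 0; set r := rsubmx v; have [->|a_neq0] := eqVneq a 0.
  rewrite scale0r add0r => rX0; suff -> : r = 0 by rewrite raddf0 row_mx0.
  by apply: (row_free_inj freeX); rewrite /= rX0 mul0mx.
move=> /eqP; rewrite addr_eq0 => /eqP auE; case/negP: uX.
apply/submxP; exists (- a^-1 *: r).
by rewrite -scalemxAl scaleNr -scalerN -auE scalerA mulVf // scale1r.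
Qed.

Lemma row_free_row (F : fieldType) (n : nat) (u : 'rV[F]_n) :
  u != 0 -> row_free u.
Proof. by move=> u_neq0; rewrite /row_free rank_rV u_neq0. Qed.

(** The matrix [B] sends the rows of [Y] to those of [X] but need not be invertible; as [Y *m B] and
    [Y] have the same rank, [complete_unitmx] gives a unit that agrees with [B] on [Y]. *)
Lemma unitmx_transitive (F : fieldType) (k n : nat) (X Y : 'M[F]_(k, n)) :
  row_free X -> row_free Y -> exists2 A, A \in unitmx & Y *m A = X.
Proof.
move=> freeX freeY; pose B := pinvmx Y *m X.
have YB : Y *m B = X by rewrite mulmxA mulmxVp // mul1mx.
have [|A Aunit YA] := @complete_unitmx _ _ _ Y B.
  by rewrite YB (eqP freeX) (eqP freeY).
by exists A; rewrite // -YA.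
Qed.

Lemma mulmx_unit_eq0 (F : fieldType) (n : nat) (a : 'rV[F]_n) (A : 'M[F]_n) :
  A \in unitmx -> (a *m A == 0) = (a == 0).
Proof.
by move=> Aunit; rewrite -(can_eq (mulmxK Aunit) a 0) mul0mx.
Qed.

Lemma F2_cases (x : 'F_2) : x = 0 \/ x = 1.
Proof. by case: x => [[|[|//]] ltx]; [left | right]; apply: val_inj. Qed.

Lemma F2_neq (x y z : 'F_2) : x != z -> y != z -> x = y.
Proof. by case: (F2_cases x) (F2_cases y) (F2_cases z) => -> [] -> [] ->. Qed.

Lemma addvv (n : nat) (u : 'rV['F_2]_n) : u + u = 0.
Proof. by apply/rowP => i; rewrite !mxE addrr_pchar2 // pchar_Fp. Qed.

Lemma row_free_pair (n : nat) (u v : 'rV['F_2]_n) :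
  u != 0 -> v != 0 -> u != v -> row_free (col_mx u v).
Proof.
move=> u0 v0 uv; apply: row_free_col_mx; first exact: row_free_row.
apply/negP => /sub_rVP[a uE]; case: (F2_cases a) uE => -> uE.
- by rewrite uE scale0r eqxx in u0.
- by rewrite uE scale1r eqxx in uv.
Qed.

Lemma row_free_triple (n : nat) (u v w : 'rV['F_2]_n) :
  u != 0 -> v != 0 -> u != v -> w \notin [:: 0; u; v; u + v] ->
  row_free (col_mx w (col_mx u v)).
Proof.
move=> u0 v0 uv wP; apply: row_free_col_mx; first exact: row_free_pair.
apply: contra wP => /submxP[r ->].
rewrite -[r]hsubmxK mul_row_col [lsubmx r]mx11_scalar [rsubmx r]mx11_scalar.
rewrite !mul_scalar_mx; case: (F2_cases (lsubmx r 0 0)) => ->;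
  case: (F2_cases (rsubmx r 0 0)) => ->;
  by rewrite ?scale0r ?scale1r ?addr0 ?add0r !inE eqxx ?orbT.
Qed.

Lemma unitmx_transitive1 (n : nat) (u u' : 'rV['F_2]_n) :
  u != 0 -> u' != 0 -> exists2 A, A \in unitmx & u' *m A = u.
Proof. by move=> u0 u'0; apply: unitmx_transitive; apply: row_free_row. Qed.

Lemma unitmx_transitive2 (n : nat) (u v u' v' : 'rV['F_2]_n) :
  u != 0 -> v != 0 -> u != v -> u' != 0 -> v' != 0 -> u' != v' ->
  exists2 A, A \in unitmx & u' *m A = u /\ v' *m A = v.
Proof.
move=> u0 v0 uv u'0 v'0 uv'.
have [A Aunit] :=
  unitmx_transitive (row_free_pair u0 v0 uv) (row_free_pair u'0 v'0 uv').
by rewrite mul_col_mx => /eq_col_mx[uE vE]; exists A.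
Qed.

Lemma unitmx_transitive3 (n : nat) (u v w u' v' w' : 'rV['F_2]_n) :
  u != 0 -> v != 0 -> u != v -> w \notin [:: 0; u; v; u + v] ->
  u' != 0 -> v' != 0 -> u' != v' -> w' \notin [:: 0; u'; v'; u' + v'] ->
  exists2 A, A \in unitmx & [/\ u' *m A = u, v' *m A = v & w' *m A = w].
Proof.
move=> u0 v0 uv wP u'0 v'0 uv' wP'.
have [A Aunit] :=
  unitmx_transitive (row_free_triple u0 v0 uv wP)
    (row_free_triple u'0 v'0 uv' wP').
by rewrite !mul_col_mx => /eq_col_mx[wE /eq_col_mx[uE vE]]; exists A.
Qed.

(** * Weights, character sums and the size of [rho] *)

Lemma card_rV2 (n : nat) : #|'rV['F_2]_n| = (2 ^ n)%N.
Proof. by rewrite card_mx card_Fp // mul1n. Qed.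

Lemma wtE (n : nat) (f : boolfun n) : wt f = (\sum_a (f a == 1%R))%N.
Proof.
rewrite /wt cardsE -sum1_card [LHS]big_mkcond /=; apply: eq_bigr => a _.
by rewrite unfold_in; case: (F2_cases (f a)) => ->.
Qed.

Lemma sum_sign (n : nat) (f : boolfun n) :
  (\sum_a (-1) ^+ f a)%R = ((2 ^ n)%:R - 2 * (wt f)%:R)%R :> int.
Proof.
have signE a : ((-1) ^+ f a)%R = (1 - 2 * (f a == 1)%:R)%R :> int.
  by case: (F2_cases (f a)) => ->.
under eq_bigr do rewrite signE.
rewrite sumrB sumr_const card_rV2 -mulr_sumr -natr_sum.
by rewrite wtE.
Qed.

Lemma Iq_wt (n : nat) (q : boolfun n) :
  Iq q = (2 ^ n)%:R - 2 * (wt q)%:R.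
Proof. exact: sum_sign. Qed.

Lemma rho_lt (R : realType) (n : nat) (q : boolfun n) :
  (0 < n)%N -> (2 <= wt q)%N -> rho R q <= 2 * (wt q)%:R - 1.
Proof.
move=> n0 wq; rewrite /rho ceil_le_int Iq_wt.
have N1 : (1 : R) < 2 ^+ n by rewrite exprn_egt1 ?ltr1n -?lt0n.
have wq' : (2 : R) <= (wt q)%:R by rewrite ler_nat.
rewrite !(rmorphB, rmorphM, rmorph_nat) /= natrX mulnC exprM.
move: (2 ^+ n) (wt q)%:R N1 wq' => N w N1 w2.
rewrite -[leRHS]ger0_norm ?rmorph1; last by lra.
rewrite -sqrtr_sqr ler_sqrt ?sqr_ge0 // ler_pdivrMr; last by lra.
(* With [I = N - 2w] one has [N^2 - I^2 = 4w(N - w)], and [(2w - 1)^2 (N - 1) - 4w(N - w)] equals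
   [4w(w - 2)(N - 1) + 4w(w - 1) + (N - 1)]. *)
have h1 : 0 <= w * (w - 2) * (N - 1) by rewrite !mulr_ge0 //; lra.
have h2 : 0 <= w * (w - 1) by rewrite mulr_ge0 //; lra.
nra.
Qed.

Lemma wt_act (n : nat) (q : boolfun n) (A : 'M['F_2]_n) :
  A \in unitmx -> wt (act q A) = wt q.
Proof.
move=> Aunit; rewrite /wt -[in RHS](card_imset _ (can_inj (mulmxKV Aunit))).
apply: eq_card => a; apply/idP/imsetP; rewrite inE ffunE.
- by move=> qa; exists (a *m A); rewrite ?inE // mulmxK.
- by case=> b; rewrite inE => qb ->; rewrite mulmxKV.
Qed.

Lemma W_const_on_support (n : nat) (f g : boolfun n) (c : 'F_2) :
  (0 < n)%N -> balanced f -> (forall a, g a = 1 -> f a = c) ->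
  `|W f g| = 2 * (wt g)%:R.
Proof.
move=> n0 bf fc.
(* Adding [g] flips the sign only on the support of [g], where the sign of [f] is [(-1) ^+ c]; the
   unflipped sum vanishes by balance. *)
have termE a : ((-1) ^+ (f a + g a)%R)%R =
    ((-1) ^+ f a - 2 * (-1) ^+ c * (g a == 1)%:R)%R :> int.
  case: (F2_cases (g a)) (fc a) => ->; first by rewrite addr0 mulr0 subr0.
  by move=> -> //; case: (F2_cases c) => ->.
have sumg : (\sum_a (g a == 1)%:R)%R = (wt g)%:R :> int.
  by rewrite -natr_sum wtE.
have sumf : (\sum_a (-1) ^+ f a)%R = 0 :> int.
  by rewrite sum_sign bf -natrM -expnS prednK // subrr.
rewrite /W; under eq_bigr do rewrite termE.
rewrite sumrB -mulr_sumr sumg sumf sub0r normrN !normrM normr_sign mulr1.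
by rewrite !ger0_norm.
Qed.

(** The bound in [nearly_bent] enters the case analysis below only through this lemma. *)
Lemma nearly_bent_not_const (R : realType) (n : nat) (q f : boolfun n)
    (A : 'M['F_2]_n) (c : 'F_2) :
  (0 < n)%N -> (2 <= wt q)%N -> nearly_bent R q f -> A \in unitmx ->
  ~ (forall a, q (a *m A) = 1 -> f a = c).
Proof.
move=> n0 wq [bf small] Aunit fc; have := small A Aunit.
rewrite /Wq (@W_const_on_support _ _ _ c) // => [|a]; last first.
  by rewrite ffunE; apply: fc.
move=> /le_trans/(_ (rho_lt R n0 wq)); rewrite wt_act //; lia.
Qed.

(** * Counting, and criteria for being affine *)

Lemma exists_in_not_seq (T : finType) (D : {set T}) (s : seq T) :
  (size s < #|D|)%N -> exists2 x, x \in D & x \notin s.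
Proof.
move=> sD; have : ~~ (D \subset s).
  apply: contraL sD => /subset_leq_card Ds; rewrite -leqNgt.
  exact: leq_trans Ds (card_size s).
by case/subsetPn=> x xD xs; exists x.
Qed.

(** The hypothesis makes [f + f 0] additive, hence linear, the only scalars being 0 and 1. *)
Lemma additive_affine (n : nat) (f : boolfun n) :
  (forall a b, f (a + b) = f a + f b + f 0) -> affine f.
Proof.
move=> fD; pose g a := f a + f 0.
have F2K (x : 'F_2) : x + x = 0 by rewrite addrr_pchar2 // pchar_Fp.
have g0 : g 0 = 0 by rewrite /g F2K.
have gD a b : g (a + b) = g a + g b.
  by rewrite /g fD -!addrA; congr (_ + _); rewrite addrCA.
exists (\col_i g (delta_mx 0 i)), (f 0) => a.
have -> : f a = g a + f 0 by rewrite /g -addrA F2K addr0.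
congr (_ + _); rewrite mxE [in LHS](row_sum_delta a) (big_morph g gD g0).
apply: eq_bigr => i _; rewrite mxE.
by case: (F2_cases (a 0 i)) => ->; rewrite ?scale0r ?scale1r ?mul0r ?mul1r.
Qed.

Lemma sum_free_affine (n : nat) (f : boolfun n) :
  #|[set a | f a != f 0]| = #|[set a | f a == f 0]| ->
  (forall u v, f u != f 0 -> f v != f 0 -> f (u + v) = f 0) -> affine f.
Proof.
move=> cardT TD; apply: additive_affine.
have shift v : f v != f 0 -> forall a, f a = f 0 -> f (a + v) != f 0.
  move=> fv a fa; pose T := [set b | f b != f 0].
  (* Translation by [v] injects [T] into its complement; equal cardinalities make it onto, so it
     also carries the complement back into [T]. *)
  have : [set b + v | b in T] == [set b | f b == f 0].
    rewrite eqEcard card_imset ?cardT ?leqnn ?andbT; last exact: addIr.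
    apply/subsetP => _ /imsetP[b + ->]; rewrite !inE => fb.
    by apply/eqP/TD.
  move=> /eqP/setP/(_ a); rewrite inE fa eqxx => /imsetP[b + ->].
  by rewrite inE -addrA addvv addr0.
have F2K (x y : 'F_2) : x + x + y = y.
  by rewrite addrr_pchar2 ?add0r // pchar_Fp.
move=> a b; have [fa|fa] := eqVneq (f a) (f 0);
  have [fb|fb] := eqVneq (f b) (f 0).
- rewrite fa fb F2K; have [T0|/set0Pn[v]] := eqVneq [set a | f a != f 0] set0.
    by move: (in_set0 (a + b)); rewrite -T0 inE => /eqP.
  rewrite inE => fv.
  (* Shifting both summands by [v] puts them in [T] without changing their sum. *)
  have <- : (a + v) + (b + v) = a + b by rewrite addrACA addvv addr0.
  by apply: TD; apply: shift.
- rewrite fa addrAC F2K; apply: (@F2_neq _ _ (f 0)) => //; exact: shift.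
- rewrite fb -addrA [RHS]addrC F2K (addrC a); apply: (@F2_neq _ _ (f 0)) => //.
  exact: shift.
- by rewrite (F2_neq fa fb) F2K TD.
Qed.

Lemma balanced_card (n : nat) (f : boolfun n) : (0 < n)%N -> balanced f ->
  #|[set a | f a != f 0]| = (2 ^ n.-1)%N /\
  #|[set a | f a == f 0]| = (2 ^ n.-1)%N.
Proof.
move=> n0 bf.
have card1 : #|[set a | f a == 1]| = (2 ^ n.-1)%N := bf.
have card0 : #|[set a | f a == 0]| = (2 ^ n.-1)%N.
  apply/eqP; rewrite -(eqn_add2l #|[set a | f a == 1]|) {2}card1 addnn.
  rewrite -mul2n -expnS prednK // -card_rV2 -(cardsC [set a | f a == 1]).
  rewrite eqn_add2l; apply/eqP; apply: eq_card => a.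
  by rewrite !inE; case: (F2_cases (f a)) => ->.
case: (F2_cases (f 0)) => ->; split=> //; [rewrite -card1 | rewrite -card0];
  by apply: eq_card => a; rewrite !inE; case: (F2_cases (f a)) => ->.
Qed.

(** * Supports of size two and three *)

Section NearlyBent.

Variables (R : realType) (n : nat) (q f : boolfun n).
Hypotheses (n_gt2 : (2 < n)%N) (fq : nearly_bent R q f).

Let n_gt0 : (0 < n)%N. Proof. exact: ltn_trans n_gt2. Qed.

Let half_ge4 : (4 <= 2 ^ n.-1)%N.
Proof. by rewrite -[4%N]/(2 ^ 2)%N leq_exp2l // -ltnS prednK. Qed.

Let in_support a : (a \in [set b | q b == 1]) = (q a == 1).
Proof. by rewrite inE. Qed.

Lemma exists_neq_f0 (s : seq 'rV['F_2]_n) : (size s < 4)%N ->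
  exists x, [/\ f x != f 0, x != 0 & x \notin s].
Proof.
move=> sz; have [card_neq _] := balanced_card n_gt0 fq.1.
have [|x] := @exists_in_not_seq _ [set a | f a != f 0] s.
  by rewrite card_neq (leq_trans sz).
rewrite inE => fx xs; exists x; split=> //.
by apply: contraNneq fx => ->.
Qed.

(** Unlike in [exists_neq_f0], the vector [0] lies in this half and uses up one of its four
    guaranteed points, so [s] must be shorter by one. *)
Lemma exists_eq_f0 (s : seq 'rV['F_2]_n) : (size s < 3)%N ->
  exists x, [/\ f x = f 0, x != 0 & x \notin s].
Proof.
move=> sz; have [_ card_eq] := balanced_card n_gt0 fq.1.
have [|x] := @exists_in_not_seq _ [set a | f a == f 0] (0 :: s).
  by rewrite card_eq (leq_trans _ half_ge4).
by rewrite !inE negb_or => /eqP fx /andP[x0 xs]; exists x.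
Qed.

Lemma wt2_absurd : wt q = 2%N -> False.
Proof.
move=> wq; have notconst A c :=
  @nearly_bent_not_const R n q f A c n_gt0 (eq_leq (esym wq)) fq.
have /eqP/cards2P[x [y [xy suppE]]] := wq.
(* At most one support point is zero; it may be taken to be [x]. *)
wlog y0 : x y xy suppE / y != 0.
  move=> th; have [yE|] := eqVneq y 0; last exact: th xy suppE.
  apply: (th y x); rewrite -?yE //; first by rewrite eq_sym.
  by rewrite setUC.
have qP a : q a = 1 -> a = x \/ a = y.
  by move=> /eqP; rewrite -in_support suppE !inE => /orP[] /eqP; [left|right].
have [xE|x0] := eqVneq x 0.
  have [|z [fz z0 _]] := @exists_eq_f0 [::] => //.
  have [A Aunit zA] := unitmx_transitive1 y0 z0.
  apply: (notconst A (f 0) Aunit) => a /qP; rewrite xE -zA.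
  case=> [/eqP|/(can_inj (mulmxK Aunit)) -> //].
  by rewrite mulmx_unit_eq0 // => /eqP ->.
have [|u [fu u0 _]] := @exists_neq_f0 [::] => //.
have [|v [fv v0]] := @exists_neq_f0 [:: u] => //; rewrite inE eq_sym => uv.
have [A Aunit [uA vA]] := unitmx_transitive2 x0 y0 xy u0 v0 uv.
apply: (notconst A (f u) Aunit) => a /qP; rewrite -uA -vA.
by case=> /(can_inj (mulmxK Aunit)) -> //; apply: F2_neq fv fu.
Qed.

Lemma wt3_affine : wt q = 3%N -> affine f.
Proof.
move=> wq; have wq2 : (2 <= wt q)%N by rewrite wq.
have notconst A c := @nearly_bent_not_const R n q f A c n_gt0 wq2 fq.
(* The support is listed so that only [z] can be zero. *)
have [x [y [z [xy x0 y0 zxy qP]]]] : exists x y z,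
    [/\ x != y, x != 0, y != 0, z \notin [:: x; y] &
      forall a, q a = 1 -> a \in [:: x; y; z]].
  have : exists s, [/\ uniq s, size s = 3%N & forall a, q a = 1 -> a \in s].
    exists (enum [set a | q a == 1]); split; rewrite -?cardE ?enum_uniq //.
    by move=> a /eqP; rewrite mem_enum in_support.
  case=> -[|x [|y [|z [|? ?]]]] [] //= + _ qP => /and3P[].
  rewrite !inE !negb_or => /andP[xy xz] yz _.
  have [yx zx zy] : [/\ y != x, z != x & z != y].
    by rewrite (eq_sym y) !(eq_sym z).
  have [x_eq0|x0] := eqVneq x 0; last have [y_eq0|y0] := eqVneq y 0.
  - exists y, z, x; split; rewrite -?x_eq0 ?inE ?negb_or ?xy //.
    by move=> a /qP; rewrite !inE => /or3P[] ->; rewrite ?orbT.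
  - exists x, z, y; split; rewrite -?y_eq0 ?inE ?negb_or ?yx //.
    by move=> a /qP; rewrite !inE => /or3P[] ->; rewrite ?orbT.
  - by exists x, y, z; split; rewrite // !inE negb_or zx.
have [z_eq0|z0] := eqVneq z 0.
  have [|u [fu u0 _]] := @exists_eq_f0 [::] => //.
  have [|v [fv v0]] := @exists_eq_f0 [:: u] => //; rewrite inE eq_sym => uv.
  have [A Aunit [uA vA]] := unitmx_transitive2 x0 y0 xy u0 v0 uv.
  case: (notconst A (f 0) Aunit) => a /qP.
  rewrite !inE z_eq0 -uA -vA mulmx_unit_eq0 // !(can_eq (mulmxK Aunit)).
  by case/or3P => /eqP ->.
(* Here no [u], [v], [u + v] with [u != v] may all lie in the half [f != f 0], which is therefore
   sum-free. *)
have [z_xy|z_xy] := eqVneq z (x + y).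
  apply: sum_free_affine => [|u v fu fv].
    by have [-> ->] := balanced_card n_gt0 fq.1.
  have [->|uv] := eqVneq u v; first by rewrite addvv.
  have neq0 w : f w != f 0 -> w != 0 by apply: contraNneq => ->.
  have [A Aunit [uA vA]] :=
    unitmx_transitive2 x0 y0 xy (neq0 _ fu) (neq0 _ fv) uv.
  apply/eqP/negPn/negP => fuv; apply: (notconst A (f u) Aunit) => a /qP.
  rewrite !inE z_xy -uA -vA -mulmxDl !(can_eq (mulmxK Aunit)).
  by case/or3P => /eqP -> //; [exact: F2_neq fv fu | exact: F2_neq fuv fu].
have [|u [fu u0 _]] := @exists_neq_f0 [::] => //.
have [|v [fv v0]] := @exists_neq_f0 [:: u] => //; rewrite inE eq_sym => uv.
(* This is where four points in the half are needed: three vectors are avoided, and [0], the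
   remaining vector of the span of [u] and [v], is not in that half. *)
have [|w [fw w0 wuv]] := @exists_neq_f0 [:: u; v; u + v] => //.
have zP : z \notin [:: 0; x; y; x + y].
  by move: zxy; rewrite !inE !negb_or z0 z_xy andbT => /andP[-> ->].
have wP : w \notin [:: 0; u; v; u + v] by rewrite inE negb_or w0.
have [A Aunit [uA vA wA]] := unitmx_transitive3 x0 y0 xy zP u0 v0 uv wP.
case: (notconst A (f u) Aunit) => a /qP.
rewrite !inE -uA -vA -wA !(can_eq (mulmxK Aunit)).
by case/or3P => /eqP -> //; [exact: F2_neq fv fu | exact: F2_neq fw fu].
Qed.

End NearlyBent.

Theorem theorem5 (R : realType) (n : nat) (q : boolfun n)
    (hn : (2 < n)%N) (hq : wt q = 2%N \/ wt q = 3%N) :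
  ~ exists f : boolfun n, ~ affine f /\ nearly_bent R q f.
Proof.
case=> f [f_nonaffine fq]; case: hq => wq; first exact: wt2_absurd hn fq wq.
exact/f_nonaffine/(wt3_affine hn fq wq).
Qed.
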